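(* The single-objective BRT investment problem without component constraint, $\textsc{BRT*}(\textsc{MinImprov}/Z=\infty/|M|\ge1)$, can be solved in polynomial time if $c_e=1$ and $u_e=1$ for all $e\in E$ and $L_d=1$ for all $d\in D$.
   Context: An instance consists of: a linear graph $G=(V,E)$ with $V=\{1,\dots,n\}$, $n\in\mathbb N_{\ge1}$ (stations) and $E=\{e_i=\{i,i+1\}: i\in\{1,\dots,n-1\}\}$ (segments); upgrade costs $c_e\in\mathbb N_{\ge1}$ for $e\in E$; a finite set $M$ of municipalities with pairwise disjoint sets $E_m\subseteq E$ of consecutive segments, $\bigcup_{m\in M}E_m=E$; budget shares $b_m\in\mathbb R_{>0}$ with $\sum_{m\in M}b_m=1$; a fixed budget $v\in\mathbb R_{\ge0}$; a set of OD pairs $D\subseteq\{(i,j):i,j\in V,i\neq j\}$, where $W_d\subseteq E$ denotes the edge set of the unique path from $i$ to $j$ in $G$ for $d=(i,j)\in D$; numbers of potential passengers $a_d\in\mathbb N_{\ge1}$ for $d\in D$; infrastructure improvements $u_e\in\mathbb R_{>0}$ for $e\in E$; and thresholds $L_d\in\mathbb R_{\ge0}$ with $L_d\le\sum_{e\in W_d}u_e$ for $d\in D$. The problem is to maximize $p(F)=\sum_{d\in D}p_d(F)$ (passenger response MinImprov), where $p_d(F)=a_d$ if $L_d\le\sum_{e\in F\cap W_d}u_e$ and $p_d(F)=0$ otherwise, over all $F\subseteq E$ such that $\sum_{e\in F\cap E_m}c_e\le b_m v$ for all $m\in M$. (''$Z=\infty$'' means that there is no constraint on the number of connected components of the subgraph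 induced by $F$.) *)

(* Defs.v *)
From mathcomp Require Import all_boot all_order all_algebra.
From mathcomp Require Import reals.

Set Implicit Arguments.
Unset Strict Implicit.
Unset Printing Implicit Defensive.

Import Order.TTheory GRing.Theory Num.Theory.
Local Open Scope ring_scope.

(** * Random access machines over an ordered field

  A program manipulates finitely many named arrays of natural numbers and
  finitely many named arrays of elements of an ordered field [K].  Evaluating
  an expression costs the sum, over its nodes, of the size of the value at that
  node.  Natural numbers always have their binary length as size (logarithmic
  cost, addresses included).  The size on [K] is a parameter [sz]:
  - [sz := rat_size], the binary length of numerator and denominator, makes the
    model a logarithmic-cost RAM, which is polynomially equivalent to Turing
    machines;
  - [sz := unit_size] makes it a real RAM: each operation on [K] costs 1.
  The only flow of information from [K] to the natural numbers is through
  comparisons; there is no rounding operation. *)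

Definition nat_size (x : nat) : nat := (trunc_log 2 x).+1.
Definition rat_size (q : rat) : nat :=
  (nat_size `|numq q| + nat_size `|denq q|)%N.
Definition unit_size (K : Type) (x : K) : nat := 1%N.

Inductive nexp :=
  | NLit of nat
  | NGet of nat & nexp
  | NAdd of nexp & nexp
  | NSub of nexp & nexp
  | NMul of nexp & nexp.

Inductive kexp :=
  | KOfNat of nexp
  | KGet of nat & nexp
  | KAdd of kexp & kexp
  | KSub of kexp & kexp
  | KMul of kexp & kexp.

Inductive bexp :=
  | BLeN of nexp & nexp
  | BLeK of kexp & kexp
  | BNot of bexp
  | BAnd of bexp & bexp.

Inductive com :=
  | Skip
  | NSet of nat & nexp & nexp
  | KSet of nat & nexp & kexp
  | Seq of com & com
  | If of bexp & com & com
  | While of bexp & com.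

Record state (K : Type) := State {
  narr : nat -> nat -> nat;
  karr : nat -> nat -> K
}.

Definition upd (T : Type) (f : nat -> nat -> T) (x i : nat) (v : T) :
    nat -> nat -> T :=
  fun y j => if (y == x) && (j == i) then v else f y j.

Section Semantics.
Variables (K : realFieldType) (sz : K -> nat).
Implicit Types s : state K.

Fixpoint neval s (e : nexp) : nat :=
  match e with
  | NLit c => c
  | NGet x i => narr s x (neval s i)
  | NAdd e1 e2 => neval s e1 + neval s e2
  | NSub e1 e2 => neval s e1 - neval s e2
  | NMul e1 e2 => neval s e1 * neval s e2
  end%N.

Fixpoint keval s (e : kexp) : K :=
  match e with
  | KOfNat e => (neval s e)%:R
  | KGet x i => karr s x (neval s i)
  | KAdd e1 e2 => keval s e1 + keval s e2
  | KSub e1 e2 => keval s e1 - keval s e2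
  | KMul e1 e2 => keval s e1 * keval s e2
  end.

Fixpoint beval s (b : bexp) : bool :=
  match b with
  | BLeN e1 e2 => (neval s e1 <= neval s e2)%N
  | BLeK e1 e2 => keval s e1 <= keval s e2
  | BNot b => ~~ beval s b
  | BAnd b1 b2 => beval s b1 && beval s b2
  end.

Fixpoint ncost s (e : nexp) : nat :=
  (nat_size (neval s e) +
   match e with
   | NLit _ => 0
   | NGet _ i => ncost s i
   | NAdd e1 e2 | NSub e1 e2 | NMul e1 e2 => ncost s e1 + ncost s e2
   end)%N.

Fixpoint kcost s (e : kexp) : nat :=
  (sz (keval s e) +
   match e with
   | KOfNat e => ncost s e
   | KGet _ i => ncost s i
   | KAdd e1 e2 | KSub e1 e2 | KMul e1 e2 => kcost s e1 + kcost s e2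
   end)%N.

Fixpoint bcost s (b : bexp) : nat :=
  match b with
  | BLeN e1 e2 => (ncost s e1 + ncost s e2).+1
  | BLeK e1 e2 => (kcost s e1 + kcost s e2).+1
  | BNot b => (bcost s b).+1
  | BAnd b1 b2 => (bcost s b1 + bcost s b2).+1
  end%N.

(* [exec c s s' t]: started in [s], the program [c] halts in [s'] after time
   [t]. *)
Inductive exec : com -> state K -> state K -> nat -> Prop :=
  | ESkip s : exec Skip s s 1
  | ENSet s x i e :
      exec (NSet x i e) s
        (State (upd (narr s) x (neval s i) (neval s e)) (karr s))
        (ncost s i + ncost s e).+1
  | EKSet s x i e :
      exec (KSet x i e) s
        (State (narr s) (upd (karr s) x (neval s i) (keval s e)))
        (ncost s i + kcost s e).+1
  | ESeq c1 c2 s s1 s2 t1 t2 :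
      exec c1 s s1 t1 -> exec c2 s1 s2 t2 ->
      exec (Seq c1 c2) s s2 (t1 + t2).+1
  | EIf b c1 c2 s s' t :
      exec (if beval s b then c1 else c2) s s' t ->
      exec (If b c1 c2) s s' (bcost s b + t).+1
  | EWhileF b c s :
      ~~ beval s b -> exec (While b c) s s (bcost s b).+1
  | EWhileT b c s s1 s2 t1 t2 :
      beval s b -> exec c s s1 t1 -> exec (While b c) s1 s2 t2 ->
      exec (While b c) s s2 (bcost s b + t1 + t2).+1.

(* An input is a list of arrays of each sort; the arrays are named by their
   position, and all remaining cells are 0. *)
Record input := Input { nin : seq (seq nat); kin : seq (seq K) }.

Definition init (x : input) : state K :=
  State (fun a i => nth 0%N (nth [::] (nin x) a) i)
        (fun a i => nth 0 (nth [::] (kin x) a) i).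

Definition input_size (x : input) : nat :=
  (\sum_(l <- nin x) \sum_(a <- l) nat_size a +
   \sum_(l <- kin x) \sum_(a <- l) sz a)%N.

(* The search problem with instances [X], encoded by [enc], in which
   [sol x y] says that the final contents [y] of array [out] describe a solution
   of [x], restricted to the instances satisfying [dom]. *)
Definition poly_time_solvable (X : Type) (dom : X -> Prop) (enc : X -> input)
    (out : nat) (sol : X -> (nat -> nat) -> Prop) : Prop :=
  exists (c : com) (k : nat), forall x, dom x ->
    exists s t, [/\ exec c (init (enc x)) s t,
                    sol x (narr s out)
                  & (t <= k * input_size (enc x) ^ k + k)%N].

End Semantics.

(** * The linear graph

  With [m] segments there are [m.+1] stations, so the number of stations is
  automatically positive.  Stations and segments are numbered from 0. *)

Section LinearGraph.
Variable m : nat.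

Definition ends (e : 'I_m) : {set 'I_m.+1} :=
  [set widen_ord (leqnSn m) e; lift ord0 e].

Definition adj : rel 'I_m.+1 := fun x y => [exists e, ends e == [set x; y]].

(* Segments traversed by a simple path from [d.1] to [d.2]; a simple path has at
   most [m] vertices after its origin. *)
Definition path_edges (d : 'I_m.+1 * 'I_m.+1) : {set 'I_m} :=
  [set e | [exists p : m.-bseq 'I_m.+1,
    [&& path adj d.1 p, uniq (d.1 :: p), last d.1 p == d.2
      & ends e \in pairmap (fun x y => [set x; y]) d.1 p]]].

End LinearGraph.

(** * The BRT investment problem *)

Record instance (K : realFieldType) := Instance {
  nseg : nat;
  nmun : nat;
  cost : 'I_nseg -> nat;
  mun : 'I_nmun -> {set 'I_nseg};
  share : 'I_nmun -> K;
  budget : K;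
  od : {set 'I_nseg.+1 * 'I_nseg.+1};
  passengers : 'I_nseg.+1 * 'I_nseg.+1 -> nat;
  improvement : 'I_nseg -> K;
  threshold : 'I_nseg.+1 * 'I_nseg.+1 -> K;
  cost_gt0 : forall e, (0 < cost e)%N;
  mun_disjoint : forall i j, i != j -> [disjoint mun i & mun j];
  mun_cover : \bigcup_i mun i = [set: 'I_nseg];
  mun_consecutive : forall i (e1 e e2 : 'I_nseg),
    e1 \in mun i -> e2 \in mun i -> (e1 <= e <= e2)%N -> e \in mun i;
  share_gt0 : forall i, 0 < share i;
  share_sum : \sum_i share i = 1;
  budget_ge0 : 0 <= budget;
  od_neq : forall d, d \in od -> d.1 != d.2;
  passengers_gt0 : forall d, d \in od -> (0 < passengers d)%N;
  improvement_gt0 : forall e, 0 < improvement e;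
  threshold_ge0 : forall d, d \in od -> 0 <= threshold d;
  threshold_le : forall d, d \in od ->
    threshold d <= \sum_(e in path_edges d) improvement e
}.

Arguments nseg {K} _.
Arguments nmun {K} _.
Arguments cost {K} _ _.
Arguments mun {K} _ _.
Arguments share {K} _ _.
Arguments budget {K} _.
Arguments od {K} _.
Arguments passengers {K} _ _.
Arguments improvement {K} _ _.
Arguments threshold {K} _ _.

Section Problem.
Variables (K : realFieldType) (I : instance K).
Implicit Type F : {set 'I_(nseg I)}.

Definition response F d : nat :=
  if threshold I d <= \sum_(e in F :&: path_edges d) improvement I e
  then passengers I d else 0%N.

Definition total_response F : nat := (\sum_(d in od I) response F d)%N.

Definition feasible F : Prop :=
  forall i, (\sum_(e in F :&: mun I i) cost I e)%:R <= share I i * budget I.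

Definition optimal F : Prop :=
  feasible F /\
  forall F', feasible F' -> (total_response F' <= total_response F)%N.

(* The partition of the segments into municipalities is encoded by listing, for
   each segment, the index of its municipality; the default value is never used,
   by [mun_cover]. *)
Definition owner (e : 'I_(nseg I)) : nat :=
  if [pick i | e \in mun I i] is Some i then i : nat else nmun I.

Definition brt_input : input K :=
  Input
    [:: [:: (nseg I).+1; nmun I; #|od I|];
        [seq cost I e | e <- enum 'I_(nseg I)];
        [seq owner e | e <- enum 'I_(nseg I)];
        [seq nat_of_ord d.1 | d <- enum (od I)];
        [seq nat_of_ord d.2 | d <- enum (od I)];
        [seq passengers I d | d <- enum (od I)]]
    [:: [:: budget I];
        [seq share I i | i <- enum 'I_(nmun I)];
        [seq improvement I e | e <- enum 'I_(nseg I)];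
        [seq threshold I d | d <- enum (od I)]].

(* A set of segments is output as its (nonzero) indicator vector. *)
Definition brt_solution (y : nat -> nat) : Prop :=
  optimal [set e : 'I_(nseg I) | y e != 0%N].

Definition unit_instance : Prop :=
  [/\ forall e, cost I e = 1%N, forall e, improvement I e = 1
    & forall d, d \in od I -> threshold I d = 1].

End Problem.

(* The array in which the solution is expected; it is not an input array. *)
Definition brt_out : nat := 6.

(* Main.v *)
Require Import Defs.
From mathcomp Require Import all_boot all_order all_algebra.
From mathcomp Require Import reals.
From mathcomp Require Import zify.

(** With unit costs, improvements and thresholds, an OD pair responds as soon as
  one segment of its interval is upgraded.  Charging the pair to the first such
  segment, the contribution of upgrading [e] depends only on the last upgraded
  segment before [e], and the budget constraint only on the number of upgrades
  so far in the current municipality, since municipalities are intervals.  Hence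
  a dynamic program over the triples (remaining segments, last upgrade, upgrades
  in the current municipality) is exact, and a forward walk through its
  decisions outputs an optimal set.

  For the running time, programs are written with counting loops whose bounds
  are read from the input header, so that the number of steps is at most a
  static polynomial.  Stored numbers are built without multiplication, so each
  step increases their length by a constant, and the logarithmic cost is
  polynomial too; elements of the field are only compared, in the test
  [q <= b_m v]. *)

Set Implicit Arguments.
Unset Strict Implicit.
Unset Printing Implicit Defensive.

Import Order.TTheory GRing.Theory Num.Theory.

(** * Counting programs and their running time *)

Lemma nat_size_le n b : n < 2 ^ b.+1 -> nat_size n <= b.+1.
Proof.
move=> lt_n; rewrite /nat_size ltnS.
case: n lt_n => [|n] lt_n; first by rewrite trunc_log0.
by rewrite -ltnS -(ltn_exp2l _ _ (ltnSn 1)) (leq_ltn_trans _ lt_n) ?trunc_logP.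
Qed.

Lemma ltn_nat_size n : n < 2 ^ nat_size n.
Proof. exact: trunc_log_ltn. Qed.

Lemma nat_sizeM x y : nat_size (x * y) <= nat_size x + nat_size y.
Proof.
have -> : nat_size x + nat_size y = (nat_size x + nat_size y).-1.+1 by [].
apply: nat_size_le; rewrite prednK // expnD.
by rewrite ltn_mul // ltn_nat_size.
Qed.

(** Assignments reach only arrays of naturals, so the field arrays keep their input values, and
    every loop has a bound known in advance. *)
Inductive prog :=
  | PSkip
  | PSet of nat & nexp & nexp
  | PSeq of prog & prog
  | PIf of bexp & prog & prog
  | PFor of nat & nat & nat & prog.

Definition var x := NGet x (NLit 0).
Definition succ_of x := NAdd (var x) (NLit 1).
Definition for_test v i c :=
  BNot (BLeN (NSub (NGet 0 (NLit i)) (NLit c)) (var v)).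

(* [PFor v i c p] runs [p] for [v = 0, ..., n - 1], where
   [n] is cell [i] of array 0, minus [c]. *)
Fixpoint compile p : com :=
  match p with
  | PSkip => Skip
  | PSet x i e => NSet x i e
  | PSeq p q => Seq (compile p) (compile q)
  | PIf b p q => If b (compile p) (compile q)
  | PFor v i c p =>
      Seq (NSet v (NLit 0) (NLit 0))
        (While (for_test v i c) (Seq (compile p) (NSet v (NLit 0) (succ_of v))))
  end.

Fixpoint writes x p : bool :=
  match p with
  | PSkip => false
  | PSet y _ _ => x == y
  | PSeq p q | PIf _ p q => writes x p || writes x q
  | PFor v _ _ p => (x == v) || writes x p
  end.

(* Products occur only inside addresses and tests, so that one
   assignment increases the length of stored numbers by a constant. *)
Fixpoint additive (e : nexp) : bool :=
  match e with
  | NLit _ | NGet _ _ => true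
  | NAdd e1 e2 | NSub e1 e2 => additive e1 && additive e2
  | NMul _ _ => false
  end.

Fixpoint simple_test (b : bexp) : bool :=
  match b with
  | BLeN _ _ => true
  | BLeK (KOfNat _) (KMul (KGet _ _) (KGet _ _)) => true
  | BLeK _ _ => false
  | BNot b => simple_test b
  | BAnd b1 b2 => simple_test b1 && simple_test b2
  end.

(** Array 0 holds the loop bounds and a body never writes its own counter, so the number of
    iterations is fixed when a loop is entered. *)
Fixpoint wf p : bool :=
  match p with
  | PSkip => true
  | PSet x _ e => (x != 0) && additive e
  | PSeq p q => wf p && wf q
  | PIf b p q => [&& simple_test b, wf p & wf q]
  | PFor v _ _ p => [&& v != 0, ~~ writes v p & wf p]
  end.

Fixpoint esize (e : nexp) : nat :=
  match e with
  | NLit c => c.+1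
  | NGet _ e => (esize e).+1
  | NAdd e1 e2 | NSub e1 e2 | NMul e1 e2 => (esize e1 + esize e2).+1
  end.

Fixpoint growth p X : nat :=
  match p with
  | PSkip => 0
  | PSet _ _ e => esize e
  | PSeq p q | PIf _ p q => growth p X + growth q X
  | PFor v _ _ p => 1 + X * (growth p X + esize (succ_of v))
  end.

(** A bound on the number of nodes times a bound on the length of the value at a node, when stored
    numbers are at most [2 ^ B]. *)
Definition etime (e : nexp) B := esize e * (B * esize e).+1.

(** [KOfNat e] pays for [e] and once more for its value; the four [B] pay for the two factors and
    their product. The value 0 is reached only for tests that [simple_test] rejects. *)
Fixpoint btime (b : bexp) B : nat :=
  match b with
  | BLeN e1 e2 => (etime e1 B + etime e2 B).+1
  | BLeK (KOfNat e) (KMul (KGet _ i) (KGet _ j)) =>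
      2 * etime e B + etime i B + etime j B + 4 * B + 2
  | BLeK _ _ => 0
  | BNot b => (btime b B).+1
  | BAnd b1 b2 => (btime b1 B + btime b2 B).+1
  end.

Definition stime (i e : nexp) B := (etime i B + etime e B).+1.

Fixpoint ptime p X B : nat :=
  match p with
  | PSkip => 1
  | PSet _ i e => stime i e B
  | PSeq p q => (ptime p X B + ptime q X B).+1
  | PIf b p q => (btime b B + (ptime p X B + ptime q X B)).+1
  | PFor v i c p =>
      let test := btime (for_test v i c) B in
      let inc := stime (NLit 0) (succ_of v) B in
      (stime (NLit 0) (NLit 0) B
       + (X * (test + (ptime p X B + inc).+1).+1 + test.+1)).+1
  end.

Definition bounded (B : nat) (a : nat -> nat -> nat) :=
  forall x i, a x i <= 2 ^ B.

Lemma bounded_leq B B' a : B <= B' -> bounded B a -> bounded B' a.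
Proof. by move=> leB Ba x i; rewrite (leq_trans (Ba x i)) ?leq_pexp2l. Qed.

Lemma bounded_upd B a x i v :
  bounded B a -> v <= 2 ^ B -> bounded B (upd a x i v).
Proof. by move=> Ba lev y j; rewrite /upd; case: ifP. Qed.

Section Compile.
Variables (K : realFieldType) (sz : K -> nat).
Hypothesis sz_nat : forall n, sz n%:R <= (nat_size n).+1.
Hypothesis sz_mul : forall x y, sz (x * y)%R <= sz x + sz y.
Variable k : nat -> nat -> K.

Fixpoint den p (a : nat -> nat -> nat) : nat -> nat -> nat :=
  match p with
  | PSkip => a
  | PSet x i e => upd a x (neval (State a k) i) (neval (State a k) e)
  | PSeq p q => den q (den p a)
  | PIf b p q => if beval (State a k) b then den p a else den q a
  | PFor v i c p =>
      iter (a 0 i - c)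
        (fun a => let a := den p a in upd a v 0 (a v 0 + 1)) (upd a v 0 0)
  end.

Lemma den_seq p q a : den (PSeq p q) a = den q (den p a).
Proof. by []. Qed.

Lemma den_frame x p a i : ~~ writes x p -> den p a x i = a x i.
Proof.
elim: p a => [|y e1 e2|p IHp q IHq|b p IHp q IHq|v j c p IHp] a //=.
- by rewrite /upd => /negbTE ->.
- by rewrite negb_or => /andP[xp xq]; rewrite IHq ?IHp.
- by rewrite negb_or => /andP[xp xq]; case: ifP; rewrite ?IHp ?IHq.
rewrite negb_or => /andP[/negbTE xv xp].
elim: (_ - _) => [|n IHn] /=; first by rewrite /upd xv.
by rewrite {1}/upd xv IHp.
Qed.

Lemma wf_writes0 p : wf p -> ~~ writes 0 p.
Proof.
elim: p => [|y e1 e2|p IHp q IHq|b p IHp q IHq|v j c p IHp] //=.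
- by case/andP; rewrite eq_sym.
- by case/andP=> /IHp/negbTE -> /IHq/negbTE ->.
- by case/and3P=> _ /IHp/negbTE -> /IHq/negbTE ->.
by case/and3P=> v0 _ /IHp/negbTE ->; rewrite orbF eq_sym.
Qed.

(** The invariant rule for counting loops, with an invariant that may depend on the counter. *)
Lemma den_for_ind (P : nat -> (nat -> nat -> nat) -> Prop) v i c p n a :
  ~~ writes v p ->
  a 0 i - c = n ->
  P 0 (upd a v 0 0) ->
  (forall j a', j < n -> a' v 0 = j -> P j a' ->
     P j.+1 (upd (den p a') v 0 j.+1)) ->
  P n (den (PFor v i c p) a).
Proof.
move=> vp def_n P0 PS; rewrite /= def_n.
suff: forall n', n' <= n ->
    let a' := iter n' (fun a => let a := den p a in upd a v 0 (a v 0 + 1))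
                (upd a v 0 0) in
    a' v 0 = n' /\ P n' a'.
  by case/(_ _ (leqnn _)).
elim=> [_|j IHj] /=; first by rewrite /upd !eqxx.
move=> ltj; have [vj Pj] := IHj (ltnW ltj).
rewrite (den_frame _ 0 vp) vj addn1; split; first by rewrite /upd !eqxx.
exact: PS.
Qed.

(** Lengths add up under products, hence the factor [esize e]. This suffices for values that are
    only used and not stored. *)
Lemma neval_bound B a e :
  0 < B -> bounded B a -> neval (State a k) e <= 2 ^ (B * esize e).
Proof.
move=> B0 Ba.
have ge1 x : 0 < 2 ^ x by rewrite expn_gt0.
have add e1 e2 x y : x <= 2 ^ (B * esize e1) -> y <= 2 ^ (B * esize e2) ->
    x + y <= 2 ^ (B * (esize e1 + esize e2).+1).
  move=> hx hy; apply: leq_trans (leq_add hx hy) _.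
  have := ge1 (B * esize e1); have := ge1 (B * esize e2).
  rewrite mulnS mulnDr !expnD => h2 h1.
  have : 2 <= 2 ^ B by rewrite -{1}(expn1 2) leq_pexp2l.
  move: (2 ^ B) (2 ^ _) (2 ^ _) h1 h2 => b p q p0 q0 b2.
  apply: (@leq_trans (2 * (p * q)));
    last by rewrite (mulnC p) leq_mul2r b2 orbT.
  by nia.
elim: e => [c|x e IH|e1 IH1 e2 IH2|e1 IH1 e2 IH2|e1 IH1 e2 IH2] /=.
- apply: leq_trans (ltnW (ltn_expl c (ltnSn 1))) _.
  by rewrite leq_pexp2l //; nia.
- by apply: leq_trans (Ba _ _) _; rewrite leq_pexp2l //; nia.
- exact: add.
- by apply: leq_trans (leq_subr _ _) _; apply: leq_trans IH1 _;
    rewrite leq_pexp2l //; nia.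
apply: leq_trans (leq_mul IH1 IH2) _.
by rewrite -expnD leq_pexp2l //; nia.
Qed.

(** A sum is at most twice its larger term, so without products the length grows by a summand, and
    iterated assignments accumulate it only linearly. *)
Lemma neval_additive B a e :
  bounded B a -> additive e -> neval (State a k) e <= 2 ^ (B + esize e).
Proof.
move=> Ba.
have ge1 x : 0 < 2 ^ x by rewrite expn_gt0.
elim: e => [c|x e IH|e1 IH1 e2 IH2|e1 IH1 e2 IH2|e1 IH1 e2 IH2] //=.
- move=> _; apply: leq_trans (ltnW (ltn_expl c (ltnSn 1))) _.
  by rewrite leq_pexp2l //; lia.
- by move=> _; apply: leq_trans (Ba _ _) _; rewrite leq_pexp2l //; lia.
- case/andP=> /IH1 h1 /IH2 h2; apply: leq_trans (leq_add h1 h2) _.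
  rewrite addnS expnS mul2n -addnn.
  by apply: leq_add; rewrite leq_pexp2l //; lia.
case/andP=> /IH1 h1 _; apply: leq_trans (leq_subr _ _) _.
by apply: leq_trans h1 _; rewrite leq_pexp2l //; lia.
Qed.

Lemma nat_size_neval B a e :
  0 < B -> bounded B a -> nat_size (neval (State a k) e) <= (B * esize e).+1.
Proof.
move=> B0 Ba; apply: nat_size_le.
rewrite (leq_ltn_trans (neval_bound e B0 Ba)) // expnS.
by rewrite -[X in X < _]mul1n ltn_pmul2r // expn_gt0.
Qed.

Lemma ncost_bound B a e :
  0 < B -> bounded B a -> ncost (State a k) e <= etime e B.
Proof.
move=> B0 Ba; rewrite /etime.
elim: e => [c|x e IH|e1 IH1 e2 IH2|e1 IH1 e2 IH2|e1 IH1 e2 IH2] /=.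
- have := nat_size_neval (NLit c) B0 Ba => /= h; nia.
- have := nat_size_neval (NGet x e) B0 Ba => /= h; nia.
- have := nat_size_neval (NAdd e1 e2) B0 Ba => /= h; nia.
- have := nat_size_neval (NSub e1 e2) B0 Ba => /= h; nia.
have := nat_size_neval (NMul e1 e2) B0 Ba => /= h; nia.
Qed.

Lemma nat_size_ncost (s : state K) e : nat_size (neval s e) <= ncost s e.
Proof. by case: e => *; rewrite /= leq_addr. Qed.

Lemma bcost_bound B a b :
  0 < B -> bounded B a -> (forall x i, sz (k x i) <= B) -> simple_test b ->
  bcost sz (State a k) b <= btime b B.
Proof.
move=> B0 Ba kB.
elim: b => [e1 e2|e1 e2|b IH|b1 IH1 b2 IH2] //=; last first.
- by case/andP=> /IH1 h1 /IH2 h2; lia.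
- by case: e1 => // e; case: e2 => // -[] // x i [] // y j _ /=;
  have := ncost_bound e B0 Ba; have := ncost_bound i B0 Ba;
  have := ncost_bound j B0 Ba; have := nat_size_ncost (State a k) e;
  have := sz_nat (neval (State a k) e);
  have := kB x (neval (State a k) i); have := kB y (neval (State a k) j);
  have := sz_mul (k x (neval (State a k) i)) (k y (neval (State a k) j)); lia.
by move=> _; have := ncost_bound e1 B0 Ba; have := ncost_bound e2 B0 Ba; lia.
Qed.

Lemma growth_den X B p a :
  wf p -> (forall i, a 0 i <= X) -> bounded B a ->
  bounded (B + growth p X) (den p a).
Proof.
elim: p a B => [|y e1 e2|p IHp q IHq|b p IHp q IHq|v j c p IHp] a B.
- by rewrite /= addn0.
- move=> /andP[_ /= ae] _ Ba; apply: bounded_upd.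
    by apply: bounded_leq Ba; rewrite leq_addr.
  exact: neval_additive.
- case/andP=> wp wq aX Ba /=; rewrite addnA; apply: IHq => //.
    by move=> i; rewrite den_frame ?wf_writes0.
  exact: IHp.
- case/and3P=> _ wp wq aX Ba /=; case: ifP => _.
    by apply: bounded_leq (IHp _ _ wp aX Ba); lia.
  by apply: bounded_leq (IHq _ _ wq aX Ba); lia.
move=> /and3P[v0 vp wp] aX Ba.
set g := growth p X + esize (succ_of v).
(* Each round adds at most [g] bits. Array 0 belongs to the invariant because inner loops read their
   bounds there. *)
suff: forall n, let a' := iter n
    (fun a => let a := den p a in upd a v 0 (a v 0 + 1)) (upd a v 0 0) in
    (forall i, a' 0 i = a 0 i) /\ bounded (B + (1 + n * g)) a'.
  case/(_ (a 0 j - c)) => _; apply: bounded_leq.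
  rewrite leq_add2l leq_add2l leq_mul2r; apply/orP; right.
  exact: leq_trans (leq_subr _ _) (aX j).
elim=> [|n [IH0 IHB]] /=.
  split=> [i|]; first by rewrite /upd eq_sym (negbTE v0).
  by apply: bounded_upd => //; apply: bounded_leq Ba; lia.
split=> [i|].
  by rewrite {1}/upd eq_sym (negbTE v0) /= den_frame ?wf_writes0.
set a1 := iter n _ _ in IH0 IHB *.
have a1X i : a1 0 i <= X by rewrite IH0.
have B1 := IHp _ _ wp a1X IHB.
have -> : B + (1 + n.+1 * g) = B + (1 + n * g) + growth p X + esize (succ_of v).
  by rewrite /g; lia.
apply: bounded_upd.
  by apply: bounded_leq B1; rewrite leq_addr.
by have := @neval_additive _ _ (succ_of v) B1 isT.
Qed.

(** [B] bounds the current state and [B'] every state reached later; all steps are charged at [B'],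
    which makes their cost uniform. *)
Lemma exec_compile X B B' p a :
  wf p -> (forall i, a 0 i <= X) -> 0 < B -> bounded B a ->
  B + growth p X <= B' -> (forall x i, sz (k x i) <= B') ->
  exists2 t, exec sz (compile p) (State a k) (State (den p a) k) t
           & t <= ptime p X B'.
Proof.
move=> wfp aX B0 Ba leB kB; have B'0 : 0 < B' by lia.
have setP x i e a' : bounded B' a' ->
    exists2 t, exec sz (NSet x i e) (State a' k)
      (State (upd a' x (neval (State a' k) i) (neval (State a' k) e)) k) t
      & t <= stime i e B'.
  move=> Ba'; exists (ncost (State a' k) i + ncost (State a' k) e).+1.
    exact: (@ENSet _ sz (State a' k)).
  by rewrite ltnS leq_add ?ncost_bound.
elim: p a B wfp aX B0 Ba leB
  => [|y e1 e2|p IHp q IHq|b p IHp q IHq|v j c p IHp] a B.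
- by move=> _ _ _ _ _; exists 1 => //; apply: ESkip.
- move=> _ _ _ Ba leB; apply: setP.
  by apply: bounded_leq Ba; apply: leq_trans leB; rewrite leq_addr.
- move=> /= /andP[wp wq] aX B0 Ba leB.
  have [|t1 ex1 le1] := IHp a B wp aX B0 Ba; first by lia.
  have Bp := growth_den wp aX Ba.
  have aX' i : den p a 0 i <= X by rewrite den_frame ?wf_writes0.
  have [||t2 ex2 le2] := IHq _ (B + growth p X) wq aX' _ Bp; try lia.
  by exists (t1 + t2).+1; [apply: ESeq ex1 ex2 | lia].
- move=> /= /and3P[wb wp wq] aX B0 Ba leB.
  have Ba' : bounded B' a by apply: bounded_leq Ba; lia.
  have bb := bcost_bound B'0 Ba' kB wb.
  have [t le_t ex] : exists2 t, t <= ptime p X B' + ptime q X B' &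
      exec sz (if beval (State a k) b then compile p else compile q)
        (State a k) (State (den (PIf b p q) a) k) t.
    rewrite /=; case: ifP => _.
      have [|t ex le] := IHp a B wp aX B0 Ba; first by lia.
      by exists t => //; lia.
    have [|t ex le] := IHq a B wq aX B0 Ba; first by lia.
    by exists t => //; lia.
  by exists (bcost sz (State a k) b + t).+1; [apply: EIf | lia].
move=> /and3P[v0 vp wp] aX B0 Ba.
pose g := growth p X + esize (succ_of v).
rewrite -[growth _ _]/(1 + X * g) => leB.
set n := a 0 j - c.
have leX : n <= X by apply: leq_trans (leq_subr _ _) (aX j).
have Ba' : bounded B' a by apply: bounded_leq Ba; lia.
have [t1 ex1 le1] := setP v (NLit 0) (NLit 0) a Ba'.
set f := fun a => let a := den p a in upd a v 0 (a v 0 + 1).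
pose test := btime (for_test v j c) B'.
pose inc := stime (NLit 0) (succ_of v) B'.
(* Induction on the number [r] of remaining rounds, with [r * g] bits reserved for them. *)
suff loop r a1 B1 : 0 < B1 -> bounded B1 a1 -> B1 + r * g <= B' ->
    (forall i, a1 0 i = a 0 i) -> a1 v 0 + r = n ->
    exists2 t, exec sz
      (While (for_test v j c) (Seq (compile p) (NSet v (NLit 0) (succ_of v))))
      (State a1 k) (State (iter r f a1) k) t
      & t <= r * (test + (ptime p X B' + inc).+1).+1 + test.+1.
  have [||||t2 ex2 le2] := loop n (upd a v 0 0) B.+1 isT.
  - apply: bounded_upd => //; apply: bounded_leq Ba; lia.
  - have : n * g <= X * g by rewrite leq_mul2r leX orbT.
    by lia.
  - by move=> i; rewrite /upd eq_sym (negbTE v0).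
  - by rewrite /upd !eqxx.
  exists (t1 + t2).+1; first exact: ESeq ex1 ex2.
  rewrite /= ltnS leq_add //; apply: leq_trans le2 _.
  by rewrite leq_add2r leq_mul2r leX orbT.
elim: r a1 B1 => [|r IHr] a1 B1 B10 Ba1 leB1 a10 vr.
  have Ba1' : bounded B' a1 by apply: bounded_leq Ba1; lia.
  exists (bcost sz (State a1 k) (for_test v j c)).+1.
    apply: EWhileF => /=; rewrite negbK a10 -/n; lia.
  by rewrite mul0n add0n ltnS bcost_bound.
have Ba1' : bounded B' a1 by apply: bounded_leq Ba1; lia.
have a1X i : a1 0 i <= X by rewrite a10.
have [|t2 ex2 le2] := IHp a1 B1 wp a1X B10 Ba1; first by lia.
have Bp := growth_den wp a1X Ba1.
have Bp' : bounded B' (den p a1) by apply: bounded_leq Bp; lia.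
have [t3 ex3 le3] := setP v (NLit 0) (succ_of v) (den p a1) Bp'.
have [|||||t4 ex4 le4] := IHr (f a1) (B1 + g).
- by lia.
- have -> : B1 + g = B1 + growth p X + esize (succ_of v) by rewrite /g; lia.
  apply: bounded_upd; first by apply: bounded_leq Bp; rewrite leq_addr.
  by have := @neval_additive _ _ (succ_of v) Bp isT.
- by lia.
- by move=> i; rewrite /f /upd eq_sym (negbTE v0) /= den_frame ?wf_writes0.
- by rewrite /f /upd !eqxx /= den_frame //; lia.
exists (bcost sz (State a1 k) (for_test v j c) + (t2 + t3).+1 + t4).+1.
  rewrite iterSr; apply: EWhileT ex4.
    by rewrite /= a10 -/n; lia.
  exact: ESeq ex2 ex3.
have : bcost sz (State a1 k) (for_test v j c) <= test by apply: bcost_bound.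
rewrite mulSn; move: le3 le4; rewrite -/inc; lia.
Qed.

End Compile.

(** * Polynomial bounds on growth and time *)

Lemma growth_poly p :
  exists c d, forall X, 0 < X -> growth p X <= c * X ^ d.
Proof.
have mono X d1 d2 : 0 < X -> d1 <= d2 -> X ^ d1 <= X ^ d2.
  by move=> X0 led; rewrite leq_pexp2l.
elim: p => [|y e1 e2|p [c1 [d1 h1]] q [c2 [d2 h2]]
  |b p [c1 [d1 h1]] q [c2 [d2 h2]]|v j c p [c1 [d1 h1]]].
- by exists 0, 0.
- by exists (esize e2), 0 => X _ /=; lia.
- exists (c1 + c2), (d1 + d2) => X X0 /=.
  have := h1 X X0; have := h2 X X0.
  have := mono X d1 (d1 + d2) X0 (leq_addr _ _).
  have := mono X d2 (d1 + d2) X0 (leq_addl _ _); nia.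
- exists (c1 + c2), (d1 + d2) => X X0 /=.
  have := h1 X X0; have := h2 X X0.
  have := mono X d1 (d1 + d2) X0 (leq_addr _ _).
  have := mono X d2 (d1 + d2) X0 (leq_addl _ _); nia.
(* [succ_of v] has size 5, so any constant from [c1 + 6] on works. *)
exists (c1 + 10), d1.+1 => X X0; rewrite /growth -/growth /esize /=.
have := h1 X X0; have := mono X 0 d1 X0 isT; rewrite expnS expn0.
move: (X ^ d1) (growth p X); nia.
Qed.

Lemma btime_lin b : exists c, forall B, 0 < B -> btime b B <= c * B.
Proof.
have el e : exists c, forall B, 0 < B -> etime e B <= c * B.
  by exists (esize e * (esize e).+1) => B B0; rewrite /etime; nia.
elim: b => [e1 e2|e1 e2|b [c hc]|b1 [c1 h1] b2 [c2 h2]] /=.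
- have [c1 h1] := el e1; have [c2 h2] := el e2.
  by exists (c1 + c2).+1 => B B0; have := h1 B B0; have := h2 B B0; nia.
- case: e1 => [e|? ?|? ?|? ?|? ?]; try (exists 0; done).
  case: e2 => [?|? ?|? ?|? ?|[?|x i|? ?|? ?|? ?]
    [?|y j|? ?|? ?|? ?]]; try (exists 0; done).
  have [c1 h1] := el e; have [c2 h2] := el i; have [c3 h3] := el j.
  exists (2 * c1 + c2 + c3 + 6) => B B0.
  by have := h1 B B0; have := h2 B B0; have := h3 B B0; nia.
- by exists c.+1 => B B0; have := hc B B0; nia.
by exists (c1 + c2).+1 => B B0; have := h1 B B0; have := h2 B B0; nia.
Qed.

Lemma stime_lin i e : exists c, forall B, 0 < B -> stime i e B <= c * B.
Proof.
(* An assignment is charged exactly like a comparison of its two expressions. *)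
have [c hc] := btime_lin (BLeN i e).
by exists c => B /hc.
Qed.

Lemma ptime_poly p :
  exists c d, forall X B, 0 < X -> 0 < B -> ptime p X B <= c * X ^ d * B.
Proof.
have mono X d1 d2 : 0 < X -> d1 <= d2 -> X ^ d1 <= X ^ d2.
  by move=> X0 led; rewrite leq_pexp2l.
have add c1 d1 c2 d2 X B : 0 < X ->
    c1 * X ^ d1 * B + c2 * X ^ d2 * B <= (c1 + c2) * X ^ (d1 + d2) * B.
  move=> X0; rewrite -mulnDl leq_mul2r mulnDl; apply/orP; right.
  by rewrite leq_add // leq_mul2l mono ?orbT // ?leq_addl ?leq_addr.
have one c d X B : 0 < X -> 0 < B ->
   c * X ^ d * B + 1 <= c.+1 * X ^ d * B.
  move=> X0 B0; have : 0 < X ^ d * B by rewrite muln_gt0 expn_gt0 X0.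
  by rewrite -!mulnA mulSn addnC leq_add2r.
have lin c d X B : 0 < X -> c * B <= c * X ^ d * B.
  move=> X0; rewrite leq_mul2r leq_pmulr ?orbT // expn_gt0 X0 //.
elim: p => [|y e1 e2|p [c1 [d1 h1]] q [c2 [d2 h2]]
  |b p [c1 [d1 h1]] q [c2 [d2 h2]]|v j c p [c1 [d1 h1]]].
- by exists 1, 0 => X B X0 B0 /=; lia.
- have [c hc] := stime_lin e1 e2.
  by exists c, 0 => X B _ B0; rewrite /= muln1 hc.
- exists (c1 + c2).+1, (d1 + d2) => X B X0 B0 /=.
  have := h1 X B X0 B0; have := h2 X B X0 B0.
  have := add c1 d1 c2 d2 X B X0; have := one (c1 + c2) (d1 + d2) X B X0 B0.
  lia.
- have [c hc] := btime_lin b.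
  exists (c + (c1 + c2)).+1, (0 + (d1 + d2)) => X B X0 B0 /=.
  have := h1 X B X0 B0; have := h2 X B X0 B0; have := hc B B0.
  have := add c1 d1 c2 d2 X B X0.
  have := add c 0 (c1 + c2) (d1 + d2) X B X0.
  have := one (c + (c1 + c2)) (0 + (d1 + d2)) X B X0 B0.
  rewrite expn0 muln1; lia.
have [ct ht] := btime_lin (for_test v j c).
have [ci hi] := stime_lin (NLit 0) (succ_of v).
have [cs hs] := stime_lin (NLit 0) (NLit 0).
(* The first four summands pay for one round, the last three for the initialisation and the final
   failing test. *)
exists (ct + c1 + ci + 2 + cs + ct + 2), d1.+1 => X B X0 B0.
have := h1 X B X0 B0; have := ht B B0; have := hi B B0; have := hs B B0.
set T := btime (for_test v j c) B; set P := ptime p X B.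
set S1 := stime (NLit 0) (NLit 0) B.
set S2 := stime (NLit 0) (succ_of v) B => e1 e2 e3 e4.
rewrite -[ptime _ _ _]/((S1 + (X * (T + (P + S2).+1).+1 + T.+1)).+1).
have Xd : 0 < X ^ d1 by rewrite expn_gt0 X0.
set Y := X ^ d1 in e4 Xd *; rewrite expnS -/Y.
have YB : 0 < Y * B by rewrite muln_gt0 Xd.
have BYB : B <= Y * B by rewrite leq_pmull.
have XYB : Y * B <= X * (Y * B) by rewrite leq_pmull.
have body : (T + (P + S2).+1).+1 <= (ct + c1 + ci + 2) * (Y * B).
  have := leq_mul (leqnn ct) BYB; have := leq_mul (leqnn ci) BYB; nia.
have rest : S1 + T.+2 <= (cs + ct + 2) * (X * (Y * B)).
  have BX : B <= X * (Y * B) by lia.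
  have := leq_mul (leqnn ct) BX; have := leq_mul (leqnn cs) BX; nia.
have -> : (ct + c1 + ci + 2 + cs + ct + 2) * (X * Y) * B =
    X * ((ct + c1 + ci + 2) * (Y * B)) + (cs + ct + 2) * (X * (Y * B)).
  by lia.
apply: leq_trans (leq_add (leq_mul (leqnn X) body) rest).
set Z := X * _; lia.
Qed.

(** * Dynamic programming over the segments *)

Section Recursion.
Variables (m : nat) (ok : nat -> nat -> bool) (same : nat -> bool).
Variable w : nat -> nat -> nat.

Definition next_used e q := if same e then q else 0.

(** With [n] segments left the current one is [m - n]; [w l e] stands for the passengers charged to
    [e] when no segment from [l] up to [e] has been upgraded before. *)
Fixpoint gain (F : pred nat) n l : nat :=
  if n is n'.+1 then
    let e := m - n in
    if F e then w l e + gain F n' e.+1 else gain F n' l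
  else 0.

Fixpoint valid (F : pred nat) n q : bool :=
  if n is n'.+1 then
    let e := m - n in
    if F e then ok e q && valid F n' (next_used e q.+1)
    else valid F n' (next_used e q)
  else true.

(* The first component is the maximal gain from the last [n] segments when the
   last upgraded segment is [l.-1] (none if [l = 0]) and [q] segments of the
   current municipality are already upgraded; the second component tells whether
   to upgrade the first of these [n] segments. *)
Fixpoint best n l q : nat * bool :=
  if n is n'.+1 then
    let e := m - n in
    let v0 := (best n' l (next_used e q)).1 in
    let v1 := w l e + (best n' e.+1 (next_used e q.+1)).1 in
    if ok e q && (v0 <= v1) then (v1, true) else (v0, false)
  else (0, false).

Lemma gain_le_best F n l q : valid F n q -> gain F n l <= (best n l q).1.
Proof.
elim: n l q => [|n IHn] l q //=; set e := m - n.+1.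
case: ifP => _ => [/andP[-> /IHn h]|/IHn h] /=.
  have := h e.+1; case: ifP => /= [_|/negbT]; rewrite -?ltnNge; lia.
have := h l; case: ifP => [/andP[_]|_] /=; lia.
Qed.

Fixpoint walk e : nat * nat :=
  if e is e'.+1 then
    let: (l, q) := walk e' in
    if (best (m - e') l q).2 then (e'.+1, next_used e' q.+1)
    else (l, next_used e' q)
  else (0, 0).

Definition chosen e := (best (m - e) (walk e).1 (walk e).2).2.

Lemma walk_le e : ((walk e).1 <= e) && ((walk e).2 <= e).
Proof.
elim: e => //= e; case: (walk e) => l q /= /andP[le qe].
by rewrite /next_used; case: ifP => _ /=; case: ifP => _ /=; lia.
Qed.

(** Backwards from the last segment: at every state on the walk, [chosen] takes the branch that
    [best] records, so the maximum is attained. *)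
Lemma walk_chosen n : n <= m -> let: (l, q) := walk (m - n) in
  (gain chosen n l == (best n l q).1) && valid chosen n q.
Proof.
elim: n => [_|n IHn ltnm]; first by case: walk.
have := IHn (ltnW ltnm).
have -> : m - n = (m - n.+1).+1 by lia.
have en : m - (m - n.+1) = n.+1 by lia.
have ch : chosen (m - n.+1) =
    (best n.+1 (walk (m - n.+1)).1 (walk (m - n.+1)).2).2.
  by rewrite /chosen en.
rewrite [walk _.+1]/= en; case: (walk _) ch => l q /=; set e := m - n.+1.
move=> ->; case: (boolP (ok e q && (_ <= _))) => /=.
  by case/andP=> -> _ /andP[/eqP -> ->]; rewrite eqxx.
by move=> _ /andP[/eqP -> ->]; rewrite eqxx.
Qed.

Lemma chosen_optimal F : valid F m 0 ->
  valid chosen m 0 /\ gain F m 0 <= gain chosen m 0.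
Proof.
move=> vF; have := walk_chosen (leqnn m); rewrite subnn /=.
by case/andP=> /eqP -> ->; split=> //; apply: gain_le_best.
Qed.

End Recursion.

(** * The program *)

Definition width := NGet 0 (NLit 0).
Definition set_var x e := PSet x (NLit 0) e.
Definition address n l q := NAdd (NMul (NAdd (NMul n width) l) width) q.
Definition same_test e :=
  let e1 := NAdd e (NLit 1) in
  BAnd (BLeN (NGet 2 e) (NGet 2 e1)) (BLeN (NGet 2 e1) (NGet 2 e)).
Definition ok_test e q :=
  BLeK (KOfNat (NAdd q (NLit 1))) (KMul (KGet 1 (NGet 2 e)) (KGet 0 (NLit 0))).
(** The bounds on [l] say that the last upgrade lies before the whole interval of the pair; the
    disjunction over the two orientations is written with negations. *)
Definition first_hit_test l e i j :=
  let between i j := BAnd (BLeN i e) (BLeN (NAdd e (NLit 1)) j) in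
  BAnd (BAnd (BLeN l i) (BLeN l j))
       (BNot (BAnd (BNot (between i j)) (BNot (between j i)))).

(* Arrays: 7 = [n], 8 = [l], 9 = [q], 10 = index of an OD pair,
   11 = [weight l e], 12 and 13 = tables of the two components of [best],
   14 and 15 = current state of [walk], 16 = [e], 17 and 18 = [next_used] with
   and without an upgrade, 19 and 20 = the two candidate values. *)
Definition weight_prog :=
  PSeq (set_var 11 (NLit 0))
    (PFor 10 2 0
      (PIf (first_hit_test (var 8) (var 16)
              (NGet 3 (var 10)) (NGet 4 (var 10)))
         (set_var 11 (NAdd (var 11) (NGet 5 (var 10)))) PSkip)).

Definition used_prog :=
  PSeq (set_var 17 (NLit 0))
  (PSeq (set_var 18 (NLit 0))
     (PIf (same_test (var 16))
        (PSeq (set_var 17 (NAdd (var 9) (NLit 1)))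
              (set_var 18 (var 9))) PSkip)).

Definition choice_prog :=
  let here := address (NAdd (var 7) (NLit 1)) (var 8) (var 9) in
  PSeq (set_var 19 (NGet 12 (address (var 7) (var 8) (var 18))))
  (PSeq (set_var 20
           (NAdd (var 11)
              (NGet 12 (address (var 7) (NAdd (var 16) (NLit 1)) (var 17)))))
  (PIf (BAnd (ok_test (var 16) (var 9)) (BLeN (var 19) (var 20)))
     (PSeq (PSet 12 here (var 20)) (PSet 13 here (NLit 1)))
     (PSeq (PSet 12 here (var 19)) (PSet 13 here (NLit 0))))).

Definition cell_prog := PSeq used_prog choice_prog.

(** Round [n] fills row [n.+1], which belongs to segment [m - n.+1]; row 0 keeps the initial zeros,
    the values of [best] with no segment left. *)
Definition table_prog :=
  PFor 7 0 1
    (PSeq (set_var 16 (NSub (NSub width (NLit 2)) (var 7)))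
      (PFor 8 0 0 (PSeq weight_prog (PFor 9 0 0 cell_prog)))).

Definition walk_prog :=
  PFor 16 0 1
    (PSeq
      (PIf (BLeN (NLit 1)
             (NGet 13 (address (NSub (NSub width (NLit 1)) (var 16))
                               (var 14) (var 15))))
         (PSeq (PSet 6 (var 16) (NLit 1))
         (PSeq (set_var 14 (NAdd (var 16) (NLit 1)))
               (set_var 15 (NAdd (var 15) (NLit 1))))) PSkip)
      (PIf (same_test (var 16)) PSkip (set_var 15 (NLit 0)))).

Definition brt_prog := PSeq table_prog walk_prog.

Lemma wf_brt_prog : wf brt_prog.
Proof. by []. Qed.

Definition is_between i j e := (minn i j <= e) && (e < maxn i j).

(** * Correctness of the program *)

Section Program.
Variables (K : realFieldType) (k : nat -> nat -> K).
Variables (a0 : nat -> nat -> nat) (m : nat).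
Hypothesis a0_width : a0 0 0 = m.+1.
Hypothesis a0_fresh : forall x i, 5 < x -> a0 x i = 0.

Definition affordable e q := (q.+1%:R <= k 1 (a0 2 e) * k 0 0)%R.
Definition same_mun e := a0 2 e == a0 2 e.+1.
(** The pairs charged to [e]: their interval contains [e] and does not begin before [l], so no
    segment before [l] meets it. *)
Definition weight l e := \sum_(0 <= d < a0 0 2)
  if (l <= minn (a0 3 d) (a0 4 d)) && is_between (a0 3 d) (a0 4 d) e
  then a0 5 d else 0.

Let bst := best m affordable same_mun weight.
Let used := next_used same_mun.
Let state_at := walk m affordable same_mun weight.
Let upgraded := chosen m affordable same_mun weight.

Definition inputs_kept (a : nat -> nat -> nat) :=
  forall x i, x <= 5 -> a x i = a0 x i.

Lemma inputs_kept_upd a x i v :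
  5 < x -> inputs_kept a -> inputs_kept (upd a x i v).
Proof.
move=> x5 ka y j y5; rewrite /upd; case: eqP => [yx|_]; last exact: ka.
by rewrite yx leqNgt x5 in y5.
Qed.

Definition addr n l q := (n * m.+1 + l) * m.+1 + q.

(** Uniqueness of digits in base [m.+1], with an unrestricted leading digit. *)
Lemma addr_inj n l q n' l' q' : l <= m -> q <= m -> l' <= m -> q' <= m ->
  addr n l q = addr n' l' q' -> [/\ n = n', l = l' & q = q'].
Proof.
rewrite /addr => lm qm lm' qm' E.
have split2 x y r s : r <= m -> s <= m -> x * m.+1 + r = y * m.+1 + s ->
    x = y /\ r = s.
  move=> rm sm eq_xy.
  have := congr1 (divn^~ m.+1) eq_xy; rewrite !divnMDl // !divn_small // !addn0.
  by move=> xy; split=> //; move: eq_xy; rewrite xy; lia.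
have [E' ->] := split2 _ _ _ _ qm qm' E.
by have [-> ->] := split2 _ _ _ _ lm lm' E'.
Qed.

(* [addr] is monotone in lexicographic order, so a row is complete exactly when
   the address of its end is the address of the next row's start. *)
Definition table_upto A (a : nat -> nat -> nat) :=
  forall n l q, l <= m -> q <= m -> q + n <= m -> addr n l q < A ->
    a 12 (addr n l q) = (bst n l q).1 /\ a 13 (addr n l q) = (bst n l q).2.

Lemma weight_progP a : inputs_kept a ->
  den k weight_prog a 11 0 = weight (a 8 0) (a 16 0).
Proof.
move=> ka.
have ia x j : x <= 5 -> a x j = a0 x j by apply: ka.
pose inv d (a' : nat -> nat -> nat) :=
  [/\ inputs_kept a', a' 8 0 = a 8 0, a' 16 0 = a 16 0 &
     a' 11 0 = \sum_(0 <= d' < d)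
       if (a 8 0 <= minn (a0 3 d') (a0 4 d')) &&
          is_between (a0 3 d') (a0 4 d') (a 16 0)
       then a0 5 d' else 0].
suff [] : inv (a0 0 2) (den k weight_prog a) by [].
rewrite den_seq; set a1 := den _ _ a.
have {a1}-> : a1 = upd a 11 0 0 by [].
apply: den_for_ind => // [||j a' _ a'j [ka' a8 a16 a11]].
- by rewrite /upd /= subn0 ia.
- split=> //; last by rewrite big_geq.
  by do 2! (apply: inputs_kept_upd => //).
have ia' x i : x <= 5 -> a' x i = a0 x i by apply: ka'.
rewrite /= a'j a8 a16 !(ia' 3, ia' 4, ia' 5) //.
set b := [&& _ & _]; set d := if _ then _ else _.
have -> : d = if (a 8 0 <= minn (a0 3 j) (a0 4 j)) &&
    is_between (a0 3 j) (a0 4 j) (a 16 0)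
    then upd a' 11 0 (a' 11 0 + a0 5 j) else a'.
  rewrite /d /b /is_between; congr (if _ then _ else _). lia.
rewrite /inv big_nat_recr //=.
case: ifP => _; split=> //=; do ?(apply: inputs_kept_upd => //).
- by rewrite /upd /= a11.
- by rewrite /upd /= a11 addn0.
Qed.

Lemma table_upto_eq A a a' :
  (forall j, a' 12 j = a 12 j) -> (forall j, a' 13 j = a 13 j) ->
  table_upto A a -> table_upto A a'.
Proof. by move=> e12 e13 T n l q *; rewrite e12 e13; apply: T. Qed.

Lemma same_testP a e : inputs_kept a ->
  beval (State a k) (same_test e) = same_mun (neval (State a k) e).
Proof. by move=> ka; rewrite /= !(ka 2) // addn1 -eqn_leq. Qed.

Lemma used_progP a : inputs_kept a ->
  den k used_prog a 17 0 = used (a 16 0) (a 9 0).+1 /\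
  den k used_prog a 18 0 = used (a 16 0) (a 9 0).
Proof.
move=> ka; rewrite /used_prog !den_seq.
set a1 := den k (set_var 18 _) _.
have ka1 : inputs_kept a1 by do 2! (apply: inputs_kept_upd => //).
rewrite -[den _ _ _]/(if _ then _ else _) same_testP //.
by rewrite /used /next_used /=; case: ifP => _; rewrite /upd /= ?addn1.
Qed.

(** Both candidates are read in row [n], whose addresses lie below the current one, and writing the
    current cell leaves smaller addresses intact. *)
Lemma cell_progP a n l q : inputs_kept a ->
  a 7 0 = n -> a 8 0 = l -> a 9 0 = q -> a 16 0 = m - n.+1 ->
  a 11 0 = weight l (m - n.+1) -> n < m -> l <= m -> q <= m ->
  table_upto (addr n.+1 l q) a ->
  table_upto (addr n.+1 l q).+1 (den k cell_prog a).
Proof.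
move=> ka a7 a8 a9 a16 a11 ltnm lm qm T.
have [] := used_progP ka; rewrite a9 a16.
rewrite /cell_prog den_seq; set a1 := den k used_prog a; set e := m - n.+1.
move=> a17 a18.
have fr x i : x \notin [:: 17; 18] -> a1 x i = a x i.
  by rewrite !inE negb_or => /andP[h1 h2];
    rewrite /a1 den_frame //= !negb_or h1 h2.
have ia x i : x <= 5 -> a1 x i = a0 x i.
  by move=> x5; rewrite fr ?ka // !inE; lia.
pose v0 := a 12 (addr n l (used e q)).
pose v1 := weight l e + a 12 (addr n e.+1 (used e q.+1)).
pose b := affordable e q && (v0 <= v1).
have E x j : x \in [:: 12; 13] -> den k choice_prog a1 x j =
    if j == addr n.+1 l q then
      if x == 12 then (if b then v1 else v0) else b
    else a x j.
  rewrite !inE => x1213; rewrite /= /upd /=.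
  rewrite !(ia 0) ?(ia 2) // a0_width a17 a18 !fr // a7 a8 a9 a16 a11 !addn1.
  rewrite -/e -/(addr n l (used e q)) -/(addr n e.+1 (used e q.+1)).
  rewrite -/(addr n.+1 l q) -/(affordable e q) -/v0 -/v1 -/b.
  by case/orP: x1213 => /eqP ->; case: b; case: eqP => //= _; rewrite fr.
move=> n' l' q' lm' qm' sum'; rewrite ltnS leq_eqVlt => /orP[/eqP eq_addr|lt'].
  have [n'E l'E q'E] := addr_inj lm' qm' lm qm eq_addr; subst n' l' q'.
  rewrite !E // eqxx /bst [best _ _ _ _ n.+1]/= -/e -/used -/bst.
  have usede x : used e x <= x by rewrite /used /next_used; case: ifP.
  have em : e.+1 <= m by rewrite /e; lia.
  have row l'' q'' : l'' <= m -> q'' <= m -> addr n l'' q'' < addr n.+1 l q.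
    by rewrite /addr; nia.
  (* The guard [q + n.+1 <= m] of [table_upto] passes to row [n] even for [q.+1]. *)
  have le_q := usede q; have le_q1 := usede q.+1.
  have [|||<- _] := T n l (used e q) lm; try lia; first by apply: row; lia.
  have [|||<- _] := T n e.+1 (used e q.+1) em; try lia.
    by apply: row; lia.
  by rewrite -/v0 -/v1 -/b; case: (b).
have ne : (addr n' l' q' == addr n.+1 l q) = false by lia.
by rewrite !E // ne; apply: T.
Qed.

Lemma table_progP a :
  inputs_kept a -> (forall j, a 12 j = 0) -> (forall j, a 13 j = 0) ->
  table_upto (addr m.+1 0 0) (den k table_prog a).
Proof.
move=> ka a12 a13.
pose inv n a' := inputs_kept a' /\ table_upto (addr n.+1 0 0) a'.
suff [] : inv m (den k table_prog a) by [].
apply: den_for_ind => // [||n a1 ltnm a17 [ka1 T1]].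
- by rewrite /= ka // a0_width subn1.
- split=> [|n l q lm qm sum]; first exact: inputs_kept_upd.
  (* Addresses below row 1 force [n = 0], where the zero memory agrees with [best]. *)
  have -> : addr 1 0 0 = m.+1 * m.+1 by rewrite /addr; lia.
  move=> lt1; suff -> : n = 0 by rewrite /upd /= a12 a13.
  by move: lt1; rewrite /addr; case: n sum => // n; nia.
rewrite den_seq; set a2 := den k (set_var 16 _) a1.
have a2E : a2 = upd a1 16 0 (m - n.+1).
  by rewrite /a2 /= !(ka1 0) // a0_width a17; congr (upd _ _ _ _); lia.
pose inv2 l a' := [/\ inputs_kept a', a' 7 0 = n, a' 16 0 = m - n.+1
  & table_upto (addr n.+1 l 0) a'].
set loop2 := PFor 8 _ _ _.
suff [ka3 a37 a316 T3] : inv2 m.+1 (den k loop2 a2).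
  split; first exact: inputs_kept_upd.
  have -> : addr n.+2 0 0 = addr n.+1 m.+1 0 by rewrite /addr; lia.
  exact: table_upto_eq T3.
apply: den_for_ind => // [||l a3 ltlm a38 [ka3 a37 a316 T3]].
- by rewrite a2E /upd /= ka1 // a0_width subn0.
- by rewrite a2E; split=> //; do 2! (apply: inputs_kept_upd => //).
rewrite den_seq; set a4 := den k weight_prog a3.
have fr x j : x \notin [:: 10; 11] -> a4 x j = a3 x j.
  by rewrite !inE !negb_or => /andP[h1 h2];
    rewrite /a4 den_frame //= !negb_or h1 h2.
have ka4 : inputs_kept a4.
  by move=> x j x5; rewrite fr ?ka3 // !inE; lia.
have a411 : a4 11 0 = weight l (m - n.+1).
  by rewrite /a4 weight_progP // a38 a316.
pose inv3 q a' := [/\ inputs_kept a', a' 7 0 = n, a' 16 0 = m - n.+1,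
  a' 8 0 = l & a' 11 0 = weight l (m - n.+1) /\ table_upto (addr n.+1 l q) a'].
set loop3 := PFor 9 _ _ _.
suff [ka5 a57 a516 a58 [a511 T5]] : inv3 m.+1 (den k loop3 a4).
  split=> //; first exact: inputs_kept_upd.
  have -> : addr n.+1 l.+1 0 = addr n.+1 l m.+1 by rewrite /addr; lia.
  exact: table_upto_eq T5.
apply: den_for_ind => // [||q a5 ltqm a59 [ka5 a57 a516 a58 [a511 T5]]].
- by rewrite ka4 // a0_width subn0.
- have [E7 E16 E8] : [/\ a4 7 0 = n, a4 16 0 = m - n.+1 & a4 8 0 = l].
    by rewrite !fr.
  split=> //; first exact: inputs_kept_upd.
  by split=> //; apply: table_upto_eq T3 => j; rewrite /upd /= fr.
have fr5 x j : x \notin [:: 12; 13; 17; 18; 19; 20] ->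
    den k cell_prog a5 x j = a5 x j.
  rewrite !inE !negb_or => /and5P[h1 h2 h3 h4 /andP[h5 h6]].
  by rewrite den_frame //= !negb_or !h1 !h2 !h3 !h4 h5 h6.
have [E7 E16 E8 E11] : [/\ den k cell_prog a5 7 0 = n,
    den k cell_prog a5 16 0 = m - n.+1, den k cell_prog a5 8 0 = l &
    den k cell_prog a5 11 0 = weight l (m - n.+1)].
  by rewrite !fr5.
split=> //.
  apply: inputs_kept_upd => // x j x5.
  by rewrite fr5 ?ka5 // !inE; lia.
split=> //.
have -> : addr n.+1 l q.+1 = (addr n.+1 l q).+1 by rewrite /addr addnS.
apply: (@table_upto_eq _ (den k cell_prog a5)) => //.
exact: cell_progP.
Qed.

Lemma walk_progP a : inputs_kept a -> (forall x, a 14 x = 0) ->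
  (forall x, a 15 x = 0) -> (forall x, a 6 x = 0) ->
  table_upto (addr m.+1 0 0) a ->
  forall e, e < m -> den k walk_prog a 6 e = upgraded e.
Proof.
move=> ka a14 a15 a6 T.
pose inv e a' := [/\ inputs_kept a', table_upto (addr m.+1 0 0) a',
  a' 14 0 = (state_at e).1, a' 15 0 = (state_at e).2 &
  forall j, a' 6 j = if j < e then nat_of_bool (upgraded j) else 0].
suff [_ _ _ _ out] : inv m (den k walk_prog a).
  by move=> e ltem; rewrite out ltem.
apply: den_for_ind => // [||e a1 ltem a116 [ka1 T1 a114 a115 a16]].
- by rewrite /= ka // a0_width subn1.
- split; [exact: inputs_kept_upd | exact: T | exact: a14 | exact: a15 |].
  exact: a6.
(* This gives the guard of [table_upto] for the cell of row [m - e] that is read at segment [e]. *)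
have /andP[le_l le_q] : ((state_at e).1 <= e) && ((state_at e).2 <= e).
  exact: walk_le.
have [|||| _ T13] := T1 (m - e) (state_at e).1 (state_at e).2; try lia.
  by rewrite /addr; nia.
rewrite den_seq.
set a2 := den k (PIf _ _ _) a1.
have a2E : a2 = if upgraded e then
    upd (upd (upd a1 6 e 1) 14 0 e.+1) 15 0 (state_at e).2.+1 else a1.
  rewrite /a2 /= !(ka1 0) // a0_width a116 a114 a115 subn1 -/(addr _ _ _) T13.
  rewrite /upgraded /chosen; case: ifP;
    rewrite /bst; case: (best _ _ _ _ _ _ _).2 => //.
  by move=> _; rewrite /upd /= a116 a115 !addn1.
have ka2 : inputs_kept a2.
  by rewrite a2E; case: ifP => // _; do 3! (apply: inputs_kept_upd => //).
have a216 : a2 16 0 = e by rewrite a2E; case: ifP.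
set a3 := den k _ a2.
have a3E : a3 = if same_mun e then a2 else upd a2 15 0 0.
  rewrite /a3 -[den _ _ _]/(if _ then _ else _) same_testP //.
  by rewrite [neval _ _]a216.
have ka3 : inputs_kept a3.
  by rewrite a3E; case: ifP => // _; apply: inputs_kept_upd.
have fr x j : x \notin [:: 6; 14; 15] -> a3 x j = a1 x j.
  rewrite !inE !negb_or => /and3P[/negbTE h1 /negbTE h2 /negbTE h3].
  by rewrite a3E a2E; case: ifP => _; case: ifP => _; rewrite /upd ?h1 ?h2 ?h3.
have W : state_at e.+1 =
    if upgraded e then (e.+1, used e (state_at e).2.+1)
    else ((state_at e).1, used e (state_at e).2).
  by rewrite /upgraded /state_at /chosen [LHS]/=; case: (walk _ _ _ _ e).
split; rewrite ?W.
- exact: inputs_kept_upd.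
- by apply: table_upto_eq T1 => j; rewrite /upd /= fr.
- by rewrite a3E a2E; case: ifP; case: ifP.
- by rewrite a3E a2E /used /next_used; case: ifP; case: ifP => //= _ _;
    rewrite /upd.
move=> j; rewrite -[LHS]/(a3 6 j) ltnS.
have -> : a3 6 j = a2 6 j by rewrite a3E; case: ifP.
rewrite a2E leq_eqVlt; case: (eqVneq j e) => [->|nej] /=.
  by case: ifP => _; rewrite /upd /= ?eqxx // a16 ltnn.
by case: ifP => _; rewrite /upd /= ?(negbTE nej) a16.
Qed.

Lemma brt_progP a : (forall x i, a x i = a0 x i) ->
  forall e, e < m -> den k brt_prog a 6 e = upgraded e.
Proof.
move=> aE; rewrite /brt_prog den_seq.
have fr x j : x \in [:: 0; 1; 2; 3; 4; 5; 6; 14; 15] ->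
    den k table_prog a x j = a0 x j.
  rewrite !inE => h; rewrite -aE den_frame //.
  by do ?[case/orP: h => h]; rewrite (eqP h).
apply: walk_progP; try by move=> x; rewrite fr ?a0_fresh.
  by move=> x i x5; rewrite fr // !inE; lia.
apply: table_progP; try by move=> x; rewrite aE ?a0_fresh.
by move=> x i _.
Qed.

End Program.

(** * Paths of the linear graph *)

Section Paths.
Variable m : nat.
Implicit Types (x y : 'I_m.+1) (e : 'I_m).

Lemma ends_eq e x y : (ends e == [set x; y]) =
  ((x == e :> nat) && (y == e.+1 :> nat))
  || ((y == e :> nat) && (x == e.+1 :> nat)).
Proof.
have ew : widen_ord (leqnSn m) e = e :> nat by [].
have el : lift ord0 e = e.+1 :> nat by [].
apply/eqP/idP => [E|].
  have hx : x \in ends e by rewrite E set21.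
  have hy : y \in ends e by rewrite E set22.
  have hw : widen_ord (leqnSn m) e \in [set x; y] by rewrite -E set21.
  have hl : lift ord0 e \in [set x; y] by rewrite -E set22.
  by move: hx hy hw hl; rewrite !inE -!val_eqE /= /bump /=; lia.
case/orP=> /andP[/eqP h1 /eqP h2].
  by congr [set _; _]; apply: val_inj; rewrite /= ?h1 ?h2.
by rewrite setUC; congr [set _; _]; apply: val_inj; rewrite /= ?h1 ?h2.
Qed.

Lemma adjE x y : adj x y = (y == x.+1 :> nat) || (x == y.+1 :> nat).
Proof.
apply/existsP/idP => [[e]|]; first by rewrite ends_eq; lia.
have ltx := ltn_ord x; have lty := ltn_ord y.
case/orP=> /eqP E.
  have ltm : x < m by lia.
  by exists (Ordinal ltm); rewrite ends_eq /=; lia.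
have ltm : y < m by lia.
by exists (Ordinal ltm); rewrite ends_eq /=; lia.
Qed.

(** A simple path on a line never turns back, so its first step decides on which side its end
    lies. *)
Lemma simple_path_between x y p :
  path (@adj m) x (y :: p) -> uniq (x :: y :: p) ->
  let z := last y p in
  [/\ (y = x.+1 :> nat -> y <= z), (x = y.+1 :> nat -> z <= y) &
  forall e, ends e \in pairmap (fun x y => [set x; y]) x (y :: p) ->
    is_between x z e].
Proof.
elim: p x y => [|z p IHp] x y.
  rewrite /= adjE /is_between => xy _; split=> // e.
  by rewrite inE ends_eq; lia.
rewrite [path _ _ _]/= => /andP[]; rewrite adjE => xy yz.
rewrite cons_uniq => /andP[xn yzp].
have [] := IHp y z yz yzp; set t := last z p => up down edges.
(* The third vertex differs from the first, so the second step keeps the direction of the first. *)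
have zx : z != x :> nat.
  move: xn; rewrite !inE !negb_or => /and3P[_ ne _].
  by rewrite val_eqE eq_sym.
move: yz; rewrite [path _ _ _]/= => /andP[]; rewrite adjE => yz _.
rewrite [last _ _]/= -/t.
split; try by lia.
move=> e; rewrite [pairmap _ _ _]/= in_cons => /orP[|/edges].
  by rewrite ends_eq /is_between; lia.
by rewrite /is_between; lia.
Qed.

(** The path steps towards [y]. The distance bound on later vertices keeps them different from [x],
    which makes the path simple. *)
Lemma path_between_exists n x y : (x - y) + (y - x) = n ->
  exists p : seq 'I_m.+1,
    [/\ path (@adj m) x p, uniq p /\
         {in p, forall z : 'I_m.+1, (z - y) + (y - z) < n},
       last x p = y, size p = n &
       forall e, is_between x y e ->
         ends e \in pairmap (fun x y => [set x; y]) x p].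
Proof.
elim: n x => [|n IHn] x dist.
  exists [::]; split=> //.
  - by apply: val_inj => /=; lia.
  - by move=> e; rewrite /is_between; lia.
have lty := ltn_ord y; have ltx := ltn_ord x.
pose v := if x < y then x.+1 else x.-1.
have ltv : v < m.+1 by rewrite /v; case: ifP; lia.
have [|p [pathp [up distp] lastp sizep edges]] := IHn (Ordinal ltv).
  by rewrite /= /v; case: ifP; lia.
exists (Ordinal ltv :: p); split.
- by rewrite /= pathp andbT adjE /= /v; case: ifP; lia.
- split.
    rewrite /= up andbT; apply/negP => /distp /=.
    by rewrite /v; case: ifP; lia.
  move=> z; rewrite inE => /orP[/eqP -> /=|/distp]; last by lia.
  by rewrite /v; case: ifP; lia.
- exact: lastp.
- by rewrite /= sizep.
move=> e bt; rewrite [pairmap _ _ _]/= in_cons ends_eq.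
have [bt'|nbt] := boolP (is_between (Ordinal ltv) y e).
  by rewrite (edges e bt') orbT.
apply/orP; left; move: bt nbt; rewrite /is_between /= /v.
by case: ifP; lia.
Qed.

Lemma path_edgesE (d : 'I_m.+1 * 'I_m.+1) e :
  (e \in path_edges d) = is_between d.1 d.2 e.
Proof.
case: d => x y; rewrite inE /=; apply/existsP/idP => [[[p sp]] /=|bt].
  case: p sp => [|z p] _; first by rewrite in_nil !andbF.
  move=> /and4P[pathp up /eqP <- edge].
  by have [_ _] := simple_path_between pathp up; apply.
have [p [pathp [up distp] lastp sizep edges]] :=
  path_between_exists (erefl (x - y + (y - x))).
have sp : size p <= m.
  by rewrite sizep; have := ltn_ord x; have := ltn_ord y; lia.
exists (Bseq sp); rewrite /= pathp up lastp eqxx (edges e bt) !andbT /=.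
by apply/negP => /distp; lia.
Qed.

End Paths.

(** * Gains per OD pair and upgrade counts per municipality *)

Section Counting.
Variable (m : nat).

Lemma gain_sum (J : Type) (r : seq J) (c : J -> nat -> nat -> nat) F n l :
  gain m (fun l e => \sum_(j <- r) c j l e) F n l =
  \sum_(j <- r) gain m (c j) F n l.
Proof.
elim: n l => [|n IHn] l /=; first by rewrite big1.
by case: ifP => _; rewrite IHn -?big_split.
Qed.

Lemma eq_gain w w' F n l : (forall l e, e < m -> w l e = w' l e) -> n <= m ->
  gain m w F n l = gain m w' F n l.
Proof.
move=> ww'; elim: n l => //= n IHn l ltnm.
by rewrite ww' ?(IHn _ (ltnW ltnm)) //; lia.
Qed.

(** After the first upgrade inside the interval, [l] exceeds [minn i j] for good, so the pair is
    paid exactly once. *)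
Lemma gain_pair i j a F n l : n <= m -> l <= m - n ->
  gain m (fun l e => if (l <= minn i j) && is_between i j e then a else 0) F n l
  = if (l <= minn i j) &&
       has (fun e => F e && is_between i j e) (iota (m - n) n)
    then a else 0.
Proof.
elim: n l => [|n IHn] l ltnm lel; first by rewrite andbF.
rewrite [gain _ _ _ _ _]/= [iota _ _]/= [has _ _]/=.
have -> : (m - n.+1).+1 = m - n by lia.
(* A segment that is neither inside nor left of the interval lies right of it, as do all later
   ones. *)
have hasW : ~~ is_between i j (m - n.+1) -> minn i j <= m - n.+1 ->
    has (fun e => F e && is_between i j e) (iota (m - n) n) = false.
  move=> nb le; apply/hasP => -[e]; rewrite mem_iota => e_in /andP[_].
  by move: nb; rewrite /is_between; lia.
case: ifP => Fe; rewrite IHn ?(ltnW ltnm) //=; try lia.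
have [b|nb] := boolP (is_between i j (m - n.+1)) => /=.
  have -> : m - n <= minn i j = false.
    by move: b; rewrite /is_between; lia.
  by rewrite addn0.
rewrite andbF add0n.
case: (leqP (m - n) (minn i j)) => [le1|gt1] /=.
  by have -> : l <= minn i j by lia.
by rewrite hasW ?andbF //; lia.
Qed.

Variables (o : nat -> nat) (F : pred nat).
Hypothesis consecutive : forall e1 e e2,
  e1 <= e <= e2 -> e2 < m -> o e1 = o e2 -> o e = o e1.

Definition count_before i e := \sum_(0 <= e' < e) (F e' && (o e' == i)).

Lemma count_beforeS i e :
  count_before i e.+1 = count_before i e + (F e && (o e == i)).
Proof. by rewrite /count_before big_nat_recr. Qed.

Lemma count_before_leq i e1 e2 :
  e1 <= e2 -> count_before i e1 <= count_before i e2.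
Proof.
move/subnKC <-; elim: (_ - _) => [|n IHn]; first by rewrite addn0.
by rewrite addnS count_beforeS (leq_trans IHn) ?leq_addr.
Qed.

(** Isolates the last upgrade in [i]: the test made there already concerns the full count. *)
Lemma count_before_last i n : count_before i n = 0 \/
  exists e, [/\ e < n, F e, o e = i & count_before i n = (count_before i e).+1].
Proof.
elim: n => [|n IHn]; first by left; rewrite /count_before big_geq.
rewrite count_beforeS; case: (boolP (_ && _)) => [/andP[Fn /eqP on]|_].
  by right; exists n; rewrite addn1.
rewrite addn0; case: IHn => [->|[e [lte Fe oe ->]]]; [by left | right].
by exists e; rewrite (ltn_trans lte).
Qed.

Lemma next_used_count e : e.+1 < m ->
  next_used (fun e => o e == o e.+1) e (count_before (o e) e + F e) =
  count_before (o e.+1) e.+1.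
Proof.
move=> ltem; rewrite /next_used; case: eqP => [oe|ne].
  by rewrite count_beforeS -oe eqxx andbT.
(* When the owner changes after [e], consecutiveness excludes earlier segments of the new owner, so
   the counter restarts at 0. *)
rewrite /count_before big_nat big1 // => e' /andP[_ lte'].
case: eqP => [oe'|]; rewrite ?andbF //; case: ne.
by rewrite (@consecutive e' e e.+1) //; lia.
Qed.

(** Along the recursion [q] stays equal to the number of earlier upgrades in the municipality of the
    current segment. *)
Lemma validP (ok : nat -> nat -> bool) n : n <= m ->
  reflect (forall e, m - n <= e < m -> F e -> ok e (count_before (o e) e))
    (valid m ok (fun e => o e == o e.+1) F n
       (count_before (o (m - n)) (m - n))).
Proof.
elim: n => [_|n IHn ltnm].
  by apply: ReflectT => e; lia.
have {}IHn := IHn (ltnW ltnm).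
rewrite [valid _ _ _ _ _ _]/=.
set e := m - n.+1; have e1 : e.+1 = m - n by rewrite /e; lia.
have nextE : valid m ok (fun e => o e == o e.+1) F n
   (next_used (fun e => o e == o e.+1) e (count_before (o e) e + F e)) =
   valid m ok (fun e => o e == o e.+1) F n (count_before (o (m - n)) (m - n)).
  (* After the last segment there is no next owner, but [valid] with no segment left ignores the
     counter. *)
  case: (posnP n) => [->|n0] //; rewrite next_used_count ?e1 //; lia.
apply: (iffP idP) => [|all].
  case: ifP nextE => Fe; rewrite ?addn0 ?addn1 => ->.
    case/andP=> oke /IHn H e' /andP[le' lt'] Fe'.
    have [->//|ne] := eqVneq e' e.
    by apply: H => //; lia.
  move=> /IHn H e' /andP[le' lt'] Fe'; apply: H => //.
  have [E|ne] := eqVneq e' e; last by lia.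
  by rewrite E Fe in Fe'.
case: ifP nextE => Fe; rewrite ?addn0 ?addn1 => ->.
  rewrite all //=; last by rewrite /e; lia.
  by apply/IHn => e' he'; apply: all; lia.
by apply/IHn => e' he'; apply: all; lia.
Qed.

End Counting.

(** * Instances of the investment problem *)

Lemma leq_nth_sum (T : Type) (g : T -> nat) (x0 : T) (s : seq T) i :
  i < size s -> g (nth x0 s i) <= \sum_(x <- s) g x.
Proof.
elim: s i => // x s IHs [|i] /= lti; rewrite big_cons ?leq_addr //.
by rewrite (leq_trans (IHs i lti)) ?leq_addl.
Qed.

Lemma size_leq_sum (T : Type) (g : T -> nat) (s : seq T) :
  (forall x, 0 < g x) -> size s <= \sum_(x <- s) g x.
Proof.
move=> g0; elim: s => [|x s IHs]; rewrite ?big_cons //=.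
by have := g0 x; lia.
Qed.

(** * Initial values and array lengths against the input size *)

Section Sizes.
Variables (K : realFieldType) (sz : K -> nat).

Lemma init_narr_bound (x : input K) : bounded (input_size sz x) (narr (init x)).
Proof.
move=> j i; rewrite /init /=.
have [lt_i|le_i] := ltnP i (size (nth [::] (nin x) j)); last first.
  by rewrite nth_default.
have lt_j : j < size (nin x).
  by case: (ltnP j (size (nin x))) lt_i => // le_j; rewrite nth_default.
apply: ltnW; apply: leq_trans (ltn_nat_size _) _; rewrite leq_pexp2l //.
rewrite /input_size; apply: leq_trans (leq_addr _ _).
apply: leq_trans (leq_nth_sum (fun l => \sum_(a <- l) nat_size a) [::] lt_j).
exact: leq_nth_sum.
Qed.

Lemma init_karr_bound (x : input K) j i :
  sz (karr (init x) j i) <= sz 0%R + input_size sz x.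
Proof.
rewrite /init /=.
have [lt_i|le_i] := ltnP i (size (nth [::] (kin x) j)); last first.
  by rewrite nth_default ?leq_addr.
have lt_j : j < size (kin x).
  by case: (ltnP j (size (kin x))) lt_i => // le_j; rewrite nth_default.
rewrite /input_size addnA; apply: leq_trans (leq_addl _ _).
apply: leq_trans (leq_nth_sum (fun l => \sum_(a <- l) sz a) [::] lt_j).
exact: leq_nth_sum.
Qed.

Lemma size_nin_leq (x : input K) j :
  size (nth [::] (nin x) j) <= input_size sz x.
Proof.
have [lt_j|le_j] := ltnP j (size (nin x)); last by rewrite nth_default.
apply: leq_trans (size_leq_sum _ (g := nat_size) _) _ => //.
apply: leq_trans (leq_addr _ _).
exact: (leq_nth_sum (fun l => \sum_(a <- l) nat_size a) [::] lt_j).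
Qed.

Lemma size_kin_leq (x : input K) j : (forall a, 0 < sz a) ->
  size (nth [::] (kin x) j) <= input_size sz x.
Proof.
move=> sz0; have [lt_j|le_j] := ltnP j (size (kin x)); last first.
  by rewrite nth_default.
apply: leq_trans (size_leq_sum _ (g := sz) sz0) _.
apply: leq_trans (leq_addl _ _).
exact: (leq_nth_sum (fun l => \sum_(a <- l) sz a) [::] lt_j).
Qed.

End Sizes.

(** * Correctness on unit instances *)

Section Instance.
Variables (K : realFieldType) (I : instance K).
Hypothesis unitI : unit_instance I.
Local Notation m := (nseg I).
Local Notation s0 := (init (brt_input I)).
Local Notation a0 := (narr s0).
Local Notation k0 := (karr s0).

Lemma owner_mun (e : 'I_m) i : e \in mun I i -> owner e = i.
Proof.
rewrite /owner => ei; case: pickP => [j ej|/(_ i)]; last by rewrite ei.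
congr nat_of_ord; apply/eqP; apply: contraTT ei => ne.
by rewrite (disjointFr (mun_disjoint ne) ej).
Qed.

Lemma mem_mun (e : 'I_m) : exists i, e \in mun I i.
Proof.
have : e \in \bigcup_i mun I i by rewrite mun_cover inE.
by case/bigcupP => i _; exists i.
Qed.

Lemma a0_owner (e : 'I_m) : a0 2 e = owner e.
Proof.
rewrite /= (nth_map e) ?size_enum_ord ?ltn_ord //.
by rewrite nth_ord_enum.
Qed.

Lemma a0_mun (e : 'I_m) (i : 'I_(nmun I)) : (a0 2 e == i) = (e \in mun I i).
Proof.
rewrite a0_owner; apply/eqP/idP => [ei|/owner_mun //].
have [j ej] := mem_mun e; move: (ej); rewrite (owner_mun ej) in ei.
by rewrite (val_inj ei).
Qed.

Lemma a0_consecutive e1 e e2 :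
  e1 <= e <= e2 -> e2 < m -> a0 2 e1 = a0 2 e2 -> a0 2 e = a0 2 e1.
Proof.
move=> le12 lt2 eq12.
have lt1 : e1 < m by lia.
have lt : e < m by lia.
have [i e1i] := mem_mun (Ordinal lt1).
have E1 : a0 2 e1 = i by apply/eqP; rewrite (a0_mun (Ordinal lt1)).
have e2i : Ordinal lt2 \in mun I i.
  by rewrite -a0_mun -[_ == _]/(a0 2 e2 == i) -eq12 E1.
rewrite E1; apply/eqP; rewrite (a0_mun (Ordinal lt)).
exact: (@mun_consecutive _ I i (Ordinal lt1) (Ordinal lt) (Ordinal lt2)).
Qed.

Lemma a0_affordable (e : 'I_m) i q : e \in mun I i ->
  affordable k0 a0 e q = (q.+1%:R <= share I i * budget I)%R.
Proof.
rewrite -a0_mun /affordable => /eqP ->.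
by rewrite /= (nth_map i) ?size_enum_ord ?ltn_ord // nth_ord_enum.
Qed.

Lemma a0_weight l e : weight a0 l e =
  \sum_(d <- enum (od I))
    if (l <= minn d.1 d.2) && is_between d.1 d.2 e then passengers I d else 0.
Proof.
rewrite (big_nth (ord0, ord0)) -cardE /weight.
apply: eq_big_nat => j /andP[_ ltj]; rewrite /=.
by rewrite !(nth_map (ord0, ord0)) // -cardE.
Qed.

Definition represents (f : pred nat) (F : {set 'I_m}) :=
  forall e : 'I_m, f e = (e \in F).

(** Counts only grow from left to right, so the budget constraint of a municipality implies all its
    tests and follows from the last one. *)
Lemma feasible_valid f F : represents f F ->
  reflect (feasible F) (valid m (affordable k0 a0) (same_mun a0) f m 0).
Proof.
move=> fF.
have cardF i : \sum_(e in F :&: mun I i) cost I e = count_before (a0 2) f i m.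
  rewrite /count_before big_mkord [RHS]big_mkcond [LHS]big_mkcond /=.
  apply: eq_bigr => e _; rewrite a0_mun fF inE.
  by case: unitI => -> _ _; case: (e \in F); case: (e \in mun I i).
have := validP f a0_consecutive (affordable k0 a0) (leqnn m).
rewrite subnn {2}/count_before big_geq // => vP.
apply: (iffP vP) => [all i|feas e /andP[_ ltem] fe].
  rewrite cardF.
  have [->|[e [ltem fe oe ->]]] := count_before_last (a0 2) f i m.
    by rewrite mulr_ge0 ?budget_ge0 ?ltW ?share_gt0.
  have ei : Ordinal ltem \in mun I i by rewrite -a0_mun; apply/eqP.
  have := all e; rewrite ltem => /(_ isT fe).
  by rewrite (a0_affordable _ ei) oe.
have [i ei] := mem_mun (Ordinal ltem).
rewrite (a0_affordable _ ei); apply: le_trans (feas i).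
have /eqP oe : a0 2 e == i by rewrite (a0_mun (Ordinal ltem)).
rewrite cardF ler_nat oe -(@addn1 (count_before _ _ _ _)).
apply: leq_trans (count_before_leq _ _ _ ltem).
by rewrite count_beforeS fe oe eqxx.
Qed.

(** The gain splits into one contribution per pair; with unit data the response condition says that
    [F] meets the path. *)
Lemma response_gain f F : represents f F ->
  total_response F = gain m (weight a0) f m 0.
Proof.
move=> fF.
rewrite (eq_gain f 0 (fun l e _ => a0_weight l e) (leqnn m)).
rewrite gain_sum big_enum; apply: eq_bigr => d od_d.
rewrite gain_pair // subnn /= /response; case: unitI => _ imp ->  //.
congr (if _ then _ else _).
rewrite (eq_bigr (fun _ => 1%R)) => [|e _]; last exact: imp.
rewrite sumr_const ler1n.
apply/card_gt0P/hasP => [[e]|[e]].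
  rewrite inE path_edgesE => /andP[eF bt].
  by exists (val e); rewrite ?mem_iota ?ltn_ord // fF eF.
rewrite mem_iota => /andP[_ ltem] /andP[fe bt].
exists (Ordinal ltem); rewrite inE path_edgesE bt andbT.
by rewrite -fF.
Qed.

Lemma brt_prog_solution : @brt_solution K I (den k0 brt_prog a0 6).
Proof.
set y := den k0 brt_prog a0 6; rewrite /brt_solution.
set F0 := [set e : 'I_m | y e != 0].
pose f := chosen m (affordable k0 a0) (same_mun a0) (weight a0).
have yE e : e < m -> y e = f e.
  apply: brt_progP => // x i x5; rewrite /= nth_default //.
  by rewrite nth_default.
have fF0 : represents f F0.
  by move=> e; rewrite inE yE ?ltn_ord //; case: (f e).
have optP F' f' : represents f' F' -> feasible F' ->
    feasible F0 /\ total_response F' <= total_response F0.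
  move=> fF' /(feasible_valid fF') v'.
  have [v0 le] := chosen_optimal (weight a0) v'.
  split; first by apply/(feasible_valid fF0).
  by rewrite (response_gain fF') (response_gain fF0).
have rep F' : exists f', represents f' F'.
  exists [pred e | e \in [seq val i | i <- enum F']] => e /=.
  by rewrite (mem_map val_inj) mem_enum.
split.
  (* [optP] needs some feasible set to compare with; the empty set yields the feasibility of
     [F0]. *)
  have feas0 : feasible (set0 : {set 'I_m}).
    move=> i; rewrite set0I big_set0.
    by rewrite mulr_ge0 ?budget_ge0 ?ltW ?share_gt0.
  by have [f0 rep0] := rep set0; have [] := optP _ _ rep0 feas0.
move=> F' feas; have [f' fF'] := rep F'.
by have [] := optP F' f' fF' feas.
Qed.

(** A number may be exponential in its binary length, but each header entry is, up to one, the
    length of another input array. Hence the loop bounds are linear in the input size. *)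
Lemma brt_input_dims (sz : K -> nat) i : (forall x, 0 < sz x) ->
  a0 0 i <= (input_size sz (brt_input I)).+1.
Proof.
move=> sz0.
have m_le := size_nin_leq sz (brt_input I) 1.
have od_le := size_nin_leq sz (brt_input I) 3.
have mun_le := size_kin_leq (brt_input I) 1 sz0.
rewrite [nth _ _ _]/= size_map size_enum_ord in m_le.
rewrite [nth _ _ _]/= size_map -cardE in od_le.
rewrite [nth _ _ _]/= size_map size_enum_ord in mun_le.
by case: i => [|[|[|i]]]; rewrite [narr _ _ _]/= ?nth_nil // leqW.
Qed.

End Instance.

(** * Assembling the time bound in both cost models *)

Lemma poly_bound C D : exists k, forall N, C * N.+1 ^ D <= k * N ^ k + k.
Proof.
(* A single [k] serves as factor, exponent and summand; [2 ^ D] comes from [n.+2 <= 2 * n.+1]. *)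
exists (C * 2 ^ D + D) => -[|n].
  rewrite exp1n muln1; apply: leq_trans (leq_addl _ _).
  by apply: leq_trans (leq_addr _ _); rewrite leq_pmulr ?expn_gt0.
apply: leq_trans (leq_addr _ _).
have le1 : n.+2 ^ D <= (2 * n.+1) ^ D
  by case: (posnP D) => [->|D0]; rewrite ?expn0 ?leq_exp2r // mul2n -addnn; lia.
apply: leq_trans (leq_mul (leqnn C) le1) _.
rewrite expnMn mulnA; apply: leq_mul; first exact: leq_addr.
by rewrite leq_pexp2l // leq_addl.
Qed.

Lemma leq_nat_size x y : x <= y -> nat_size x <= nat_size y.
Proof.
by move=> le_xy; apply/nat_size_le/(leq_ltn_trans le_xy)/ltn_nat_size.
Qed.

Lemma rat_size_nat n : rat_size n%:R%R <= (nat_size n).+1.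
Proof. by rewrite -[n%:R%R]/(n%:~R)%R /rat_size numq_int denq_int /= addn1. Qed.

(** Reduction to lowest terms only divides numerator and denominator, and lengths are subadditive
    under products. *)
Lemma rat_sizeM x y : rat_size (x * y)%R <= rat_size x + rat_size y.
Proof.
rewrite {1}/rat_size [(x * y)%R]mulq_def mulq_subdefE num_fracq den_fracq /=.
rewrite -!/(numq _) -!/(denq _) mulf_neq0 ?denq_neq0 //.
set sign := (_ ^ _)%R; rewrite [absz (sign * _)%R]abszM.
have -> : absz sign = 1 by rewrite /sign; case: (_ (+) _).
rewrite mul1n !absz_nat !abszM /rat_size addnACA.
by apply: leq_add; apply: leq_trans (nat_sizeM _ _);
  apply/leq_nat_size/leq_div.
Qed.

(** The cost model enters only through these three properties of [sz], so one program serves both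
    models. *)
Lemma brt_solvable (K : realFieldType) (sz : K -> nat) :
  (forall x, 0 < sz x) -> (forall n, sz n%:R%R <= (nat_size n).+1) ->
  (forall x y, sz (x * y)%R <= sz x + sz y) ->
  poly_time_solvable sz (@unit_instance K) (@brt_input K)
    brt_out (@brt_solution K).
Proof.
move=> sz_gt0 sz_nat sz_mul.
have [c1 [d1 time]] := ptime_poly brt_prog.
have [c2 [d2 gr]] := growth_poly brt_prog.
have [k bound] := poly_bound (c1 * (2 + c2)) (d1 + d2.+1).
exists (compile brt_prog), k => I unitI.
set N := input_size sz (brt_input I).
set a := narr (init (brt_input I)); set b := karr (init (brt_input I)).
(* [N.+2] also covers [sz 0 + N], the bound for field cells: those outside the input hold 0, and
   [sz 0] is at most 2. *)
pose B := N.+2 + growth brt_prog N.+1.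
have [|||||t ex le_t] := exec_compile sz_nat sz_mul (k := b) (a := a)
    (X := N.+1) (B := N.+1) (B' := B) wf_brt_prog.
- by move=> i; apply: brt_input_dims.
- by [].
- by apply: bounded_leq (leqnSn N) _; apply: init_narr_bound.
- by rewrite /B; lia.
- move=> x i; apply: leq_trans (init_karr_bound _ _ _ _) _.
  apply: leq_trans (leq_addr _ _); rewrite -add2n leq_add2r.
  by have := sz_nat 0; rewrite mulr0n.
exists (State (den b brt_prog a) b), t; split=> //.
  exact: brt_prog_solution.
apply: leq_trans (bound N); apply: leq_trans le_t _.
have B0 : 0 < B by rewrite /B.
apply: leq_trans (time N.+1 B isT B0) _.
have leB : B <= (2 + c2) * N.+1 ^ d2.+1.
  rewrite /B mulnDl leq_add //.
    apply: (@leq_trans (2 * N.+1)).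
      by rewrite mul2n -addnn addSn ltnS leq_addl.
    by rewrite leq_mul2l /= -[X in X <= _]expn1 leq_pexp2l.
  apply: leq_trans (gr N.+1 isT) _.
  by rewrite leq_mul // leq_pexp2l.
apply: leq_trans (leq_mul (leqnn _) leB) _.
by rewrite expnD; lia.
Qed.

Theorem lemma22 (R : realType) :
  poly_time_solvable (@unit_size R) (@unit_instance R) (@brt_input R)
    brt_out (@brt_solution R)
  /\
  poly_time_solvable rat_size (@unit_instance rat) (@brt_input rat)
    brt_out (@brt_solution rat).
Proof.
split; apply: brt_solvable => //.
- exact: rat_size_nat.
- exact: rat_sizeM.
Qed.
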